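(* Let $f:\operatorname{dom} f\subseteq\mathbb{R}^n\to\mathbb{R}$, let $x^0\in\mathbb{R}^n$, let $S=[s^1\;\cdots\;s^n]\in\mathbb{R}^{n\times n}$ be full rank, let $k\in\{0,1,\dots,n\}$, and let $U_0=S$ and, for $k\ne0$, let $U_k$ be the $n\times n$ matrix whose $k$-th column is $-s^k$ and whose $i$-th column is $s^i-s^k$ for $i\ne k$. Assume that the minimal poised set for NSHC $\mathcal{M}(x^0;S,U_k)$ is contained in $\operatorname{dom} f$. Let $Q_f(x^0;S,U_k)(x)=\alpha_0+\alpha^\top x+\frac12x^\top\mathbf{H}x$ be the quadratic interpolation function of $f$ over $\mathcal{M}(x^0;S,U_k)$. Then $\mathbf{H}=S^{-\top}\widehat{\mathbf{H}}S^{-1}$, where the entries of the symmetric matrix $\widehat{\mathbf{H}}\in\mathbb{R}^{n\times n}$ are as follows. If $k\in\{1,\dots,n\}$, then $$\widehat{\mathbf{H}}_{i,k}=-f(x^0+s^i-s^k)+f(x^0+s^i)+f(x^0-s^k)-f(x^0),\quad i\in\{1,\dots,n\}\setminus\{k\},$$ $$\widehat{\mathbf{H}}_{i,i}=f(x^0+2s^i-s^k)-2f(x^0+s^i-s^k)+f(x^0-s^k),\quad i\in\{1,\dots,n\}\setminus\{k\},$$ $$\widehat{\mathbf{H}}_{k,k}=f(x^0+s^k)+f(x^0-s^k)-2f(x^0),$$ $$\widehat{\mathbf{H}}_{i,j}=f(x^0+s^i+s^j-s^k)-f(x^0+s^i-s^k)-f(x^0+s^j-s^k)+f(x^0-s^k),\quad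 i,j\in\{1,\dots,n\}\setminus\{k\},\ i\ne j.$$ If $k=0$, then $$\widehat{\mathbf{H}}_{i,i}=f(x^0+2s^i)-2f(x^0+s^i)+f(x^0),\quad i\in\{1,\dots,n\},$$ $$\widehat{\mathbf{H}}_{i,j}=f(x^0+s^i+s^j)-f(x^0+s^i)-f(x^0+s^j)+f(x^0),\quad i,j\in\{1,\dots,n\},\ i\neq j.$$ For all $k\in\{0,1,\dots,n\}$, $\alpha=S^{-\top}\overline{\alpha}$, where the entries of $\overline{\alpha}\in\mathbb{R}^n$ are $$\overline{\alpha}_i=f(x^0+s^i)-f(x^0)-\tfrac12\widehat{\mathbf{H}}_{i,i}-(x^0)^\top\mathbf{H}s^i,\quad i\in\{1,\dots,n\},$$ and $$\alpha_0=f(x^0)-\alpha^\top x^0-\tfrac12(x^0)^\top\mathbf{H}x^0.$$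
   Context: For $S=[s^1\cdots s^n]$, $T=[t^1\cdots t^n]\in\mathbb{R}^{n\times n}$, let $$\mathcal{S}(x^0;S,T)=\{x^0\}\cup\{x^0+s^i\}_{i}\cup\{x^0+t^j\}_{j}\cup\{x^0+s^i+t^j\}_{i,j}$$ (the set of distinct points used in nested-set Hessian computation, NSHC). It is a minimal poised set for NSHC at $x^0$ if $S,T$ are full rank and it has exactly $(n+1)(n+2)/2$ distinct points. For $S$ full rank, $\mathcal{M}(x^0;S,U_k)$ denotes the minimal poised set $\mathcal{S}(x^0;S,U_k)$; it is poised for quadratic interpolation, in the sense defined next. A set of distinct points $\mathcal{Y}=\{y^0,\dots,y^m\}\subset\mathbb{R}^n$ with $m=\frac12(n+1)(n+2)-1$ is poised for quadratic interpolation if the system $\alpha_0+\alpha^\top y^i+\frac12(y^i)^\top\mathbf{H}y^i=0$, $i\in\{0,\dots,m\}$, has a unique solution $\alpha_0\in\mathbb{R}$, $\alpha\in\mathbb{R}^n$, $\mathbf{H}=\mathbf{H}^\top\in\mathbb{R}^{n\times n}$. In that case, if $\mathcal{Y}\subset\operatorname{dom} f$, the quadratic interpolation function of $f$ over $\mathcal{Y}$ is $x\mapsto\alpha_0+\alpha^\top x+\frac12x^\top\mathbf{H}x$, where $(\alpha_0,\alpha,\mathbf{H}=\mathbf{H}^\top)$ is the unique solution to $\alpha_0+\alpha^\top y^i+\frac12(y^i)^\top\mathbf{H}y^i=f(y^i)$, $i\in\{0,\dots,m\}$. $S^{-\top}$ denotes $(S^\top)^{-1}$. *)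

(* Defs.v *)
From mathcomp Require Import all_boot all_order all_algebra.
From mathcomp Require Import all_classical reals.

Set Implicit Arguments.
Unset Strict Implicit.
Unset Printing Implicit Defensive.

Import Order.TTheory GRing.Theory Num.Theory.

Local Open Scope classical_set_scope.
Local Open Scope ring_scope.

Definition nshc_set (R : realType) (n : nat) (x0 : 'cV[R]_n) (S T : 'M[R]_n) :
    set 'cV[R]_n :=
  [set x0]
  `|` [set x0 + col i S | i in [set: 'I_n]]
  `|` [set x0 + col j T | j in [set: 'I_n]]
  `|` [set x0 + col ij.1 S + col ij.2 T | ij in [set: 'I_n * 'I_n]].

(* The index k = 0 is [None]; k = 1, ..., n is [Some k] with [k : 'I_n]. *)
Definition Umx (R : realType) (n : nat) (S : 'M[R]_n) (k : option 'I_n) :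
    'M[R]_n :=
  if k is Some k then
    \matrix_(l, i) (if i == k then - S l k else S l i - S l k)
  else S.

Definition Mset (R : realType) (n : nat) (x0 : 'cV[R]_n) (S : 'M[R]_n)
    (k : option 'I_n) : set 'cV[R]_n :=
  nshc_set x0 S (Umx S k).

(* Coefficients (alpha_0, alpha, H) of a quadratic function. *)
Definition quad_coef (R : realType) (n : nat) : Type :=
  (R * 'cV[R]_n * 'M[R]_n)%type.

Definition quad_eval (R : realType) (n : nat) (c : quad_coef R n)
    (x : 'cV[R]_n) : R :=
  let: (a0, a, H) := c in
  a0 + (a^T *m x) 0 0 + 2^-1 * (x^T *m H *m x) 0 0.

Definition interpolates (R : realType) (n : nat) (Y : set 'cV[R]_n)
    (g : 'cV[R]_n -> R) (c : quad_coef R n) : Prop :=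
  c.2^T = c.2 /\ forall y, Y y -> quad_eval c y = g y.

Definition poised_quad (R : realType) (n : nat) (Y : set 'cV[R]_n) : Prop :=
  (Y #= `I_((n.+1 * n.+2) %/ 2))%card /\
  exists! c : quad_coef R n, interpolates Y (fun=> 0) c.

(* [valL_ 0 f] extends [f], defined on [domf] only, by the junk value 0. *)
Definition is_quad_interp (R : realType) (n : nat) (domf : set 'cV[R]_n)
    (f : domf -> R) (Y : set 'cV[R]_n) (c : quad_coef R n) : Prop :=
  [/\ poised_quad Y, Y `<=` domf & interpolates Y (valL_ 0 f) c].

(* The coefficients satisfying [is_quad_interp], unique when they exist; the
   zero coefficients if Y is not poised or not contained in [domf]. *)
Definition quad_interp (R : realType) (n : nat) (domf : set 'cV[R]_n)
    (f : domf -> R) (Y : set 'cV[R]_n) : quad_coef R n :=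
  xget (0, 0, 0) [set c : R * 'cV[R]_n * 'M[R]_n | is_quad_interp f Y c].

(* Main.v *)
Require Import Defs.
From mathcomp Require Import all_boot all_order all_algebra.
From mathcomp Require Import all_classical reals.
From mathcomp Require Import ring.

Import Order.TTheory GRing.Theory Num.Theory.

Local Open Scope classical_set_scope.
Local Open Scope ring_scope.

(** The shift x0 |-> y = x0 - s^k turns every set M(x0; S, U_k) into the same
    picture: with s^0 = 0, it consists of the points y + s^i + s^j with
    0 <= i, j <= n, the principal lattice of order 2 of the simplex with
    vertices 2 s^0, ..., 2 s^n, translated by y (lemma [Mset_lattice]).  The
    case distinction on k disappears after that.

    For a quadratic function q with Hessian H, the second difference
    q (y + u + v) - q (y + u) - q (y + v) + q y is u^T H v.  Taking for u and v
    columns of S, all four points lie on the lattice, so S^T H S is read off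
    from the data of any quadratic interpolant
    ([interpolant_hessian]); the stated entries of Hhat are these second
    differences, written in terms of x0.  The gradient term and the constant
    follow from the values at x0 + s^i and x0.

    The formulas concern the quadratic interpolation function, which exists only
    over poised sets; so poisedness and existence have to be proved as well.
    - Counting: the s^i are affinely independent, so y + s^i + s^j determines
      the unordered pair {i, j}, and there are (n + 1)(n + 2)/2 of them
      ([card_lattice]).
    - Uniqueness: zero data have zero second differences, whence H = 0, and then
      the gradient and the constant vanish ([interpolant0]).
    - Existence: the quadratic function built from the second differences at y
      reproduces arbitrary data on the lattice ([interpolant_exists]). *)

(** * Quadratic functions *)

Lemma addmxE {R : realType} {m n : nat} (A B : 'M[R]_(m, n)) i j :
  (A + B) i j = A i j + B i j.
Proof. by rewrite mxE. Qed.

Lemma submxE {R : realType} {m n : nat} (A B : 'M[R]_(m, n)) i j :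
  (A - B) i j = A i j - B i j.
Proof. by rewrite !mxE. Qed.

Lemma bilinear_symm {R : realType} {n : nat} (H : 'M[R]_n) (u v : 'cV[R]_n) :
  H^T = H -> (u^T *m H *m v) 0 0 = (v^T *m H *m u) 0 0.
Proof.
move=> sym_H; have -> : v^T *m H *m u = (u^T *m H *m v)^T.
  by rewrite !trmx_mul trmxK sym_H mulmxA.
by rewrite [RHS]mxE.
Qed.

Lemma quad_evalD {R : realType} {n : nat} (a0 : R) (a : 'cV[R]_n) (H : 'M[R]_n)
    (y u : 'cV[R]_n) :
  H^T = H ->
  quad_eval (a0, a, H) (y + u) = quad_eval (a0, a, H) y + (a^T *m u) 0 0
    + (y^T *m H *m u) 0 0 + 2^-1 * (u^T *m H *m u) 0 0.
Proof.
move=> sym_H; rewrite /quad_eval [(y + u)^T]linearD /=.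
rewrite !(mulmxDr, mulmxDl) !addmxE.
by rewrite (bilinear_symm H u y sym_H); field.
Qed.

(** Affine terms are killed by a second difference. *)
Lemma quad_eval_diff2 {R : realType} {n : nat} (a0 : R) (a : 'cV[R]_n)
    (H : 'M[R]_n) (y u v : 'cV[R]_n) :
  let q := quad_eval (a0, a, H) in
  H^T = H ->
  (u^T *m H *m v) 0 0 = q (y + u + v) - q (y + u) - q (y + v) + q y.
Proof.
move=> q sym_H; rewrite /q !quad_evalD // [(y + u)^T]linearD /=.
by rewrite !mulmxDl !addmxE; ring.
Qed.

Lemma mulmx_col {R : realType} {n : nat} (S H : 'M[R]_n) (i j : 'I_n) :
  ((col i S)^T *m H *m col j S) 0 0 = (S^T *m H *m S) i j.
Proof. by rewrite tr_col -!row_mul colE mulmxA -colE !mxE. Qed.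

Lemma dot_col {R : realType} {n : nat} (S : 'M[R]_n) (a : 'cV[R]_n) (i : 'I_n) :
  (a^T *m col i S) 0 0 = (S^T *m a) i 0.
Proof.
by rewrite -[a^T *m _]trmxK trmx_mul trmxK tr_col -row_mul !mxE.
Qed.

(** * The second-order lattice of a simplex *)

(** The convention s^0 = 0, with [None] in the role of the index 0. *)
Definition vertex {R : realType} {n : nat} (S : 'M[R]_n) (i : option 'I_n) :
    'cV[R]_n :=
  if i is Some l then col l S else 0.

Definition lattice {R : realType} {n : nat} (y : 'cV[R]_n) (S : 'M[R]_n) :
    set 'cV[R]_n :=
  [set z | exists i j, z = y + vertex S i + vertex S j].

Lemma lattice_vertex2 {R : realType} {n : nat} (y : 'cV[R]_n) (S : 'M[R]_n)
    (i j : option 'I_n) :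
  lattice y S (y + vertex S i + vertex S j).
Proof. by exists i, j. Qed.

Lemma lattice_vertex {R : realType} {n : nat} (y : 'cV[R]_n) (S : 'M[R]_n)
    (i : option 'I_n) :
  lattice y S (y + vertex S i).
Proof. by exists i, None; rewrite addr0. Qed.

Lemma lattice_base {R : realType} {n : nat} (y : 'cV[R]_n) (S : 'M[R]_n) :
  lattice y S y.
Proof. by exists None, None; rewrite !addr0. Qed.

Lemma col_Umx {R : realType} {n : nat} (S : 'M[R]_n) (k : option 'I_n)
    (i : 'I_n) :
  col i (Umx S k) = (if Some i == k then 0 else col i S) - vertex S k.
Proof.
case: k => [k|] /=; last by rewrite subr0.
rewrite (inj_eq Some_inj); apply/matrixP => l m; rewrite !mxE.
by case: eqP => _; rewrite !mxE ?sub0r.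
Qed.

(** The columns of U_k, together with 0, are the vectors s^j - s^k for
    0 <= j <= n: the column of index k is s^0 - s^k, and 0 is s^k - s^k. *)
Lemma Mset_lattice {R : realType} {n : nat} (x0 : 'cV[R]_n) (S : 'M[R]_n)
    (k : option 'I_n) :
  Mset x0 S k = lattice (x0 - vertex S k) S.
Proof.
apply/seteqP; split => [z|z [i [j ->]]].
- case=> [[[->|[i _ <-]]|[j _ <-]]|[[i j] _ <-]] /=.
  + by exists k, None; rewrite addr0 subrK.
  + by exists k, (Some i); rewrite subrK.
  + rewrite col_Umx; case: ifP => _.
      by exists None, None; rewrite !addr0 sub0r.
    by exists None, (Some j); rewrite addr0 addrCA addrC.
  + rewrite col_Umx; case: ifP => _.
      by exists (Some i), None; rewrite addr0 sub0r addrAC.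
    by exists (Some i), (Some j); rewrite addrA addrAC [x0 - _ + _]addrAC.
- have vertex_shift l : exists m, vertex (Umx S k) m = vertex S l - vertex S k.
    have [->|lk] := eqVneq l k; first by exists None; rewrite subrr.
    case: l lk => [l|] lk.
      by exists (Some l); rewrite /= col_Umx (negPf lk).
    (* The vector s^0 - s^k is the column k of U_k. *)
    case: k lk => [k _|/eqP//]; exists (Some k).
    by rewrite [LHS]col_Umx eqxx.
  have [m Um] := vertex_shift j.
  have -> : x0 - vertex S k + vertex S i + vertex S j
          = x0 + vertex S i + vertex (Umx S k) m.
    by rewrite Um addrA [x0 - _ + _]addrAC [LHS]addrAC.
  case: i m {Um} => [i|] [m|] /=; rewrite ?addr0.
  + by right; exists (i, m).
  + by left; left; right; exists i.
  + by left; right; exists m.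
  + by left; left; left.
Qed.

(** * Counting the lattice points *)

Lemma size_sum_count {T : finType} (s : seq T) :
  size s = (\sum_(x : T) count_mem x s)%N.
Proof.
elim: s => [|a s IHs]; first by rewrite big1.
by rewrite /= big_split /= -IHs (bigD1 a) //= eqxx big1 // => x /negPf;
  rewrite eq_sym => ->.
Qed.

(** The coordinates of s^i + s^j in the basis S count the occurrences of each
    nonzero index in the pair (i, j); the occurrences of the index 0 follow,
    since there are two in total. *)
Lemma vertex2_inj {R : realType} {n : nat} (S : 'M[R]_n)
    (i j i' j' : option 'I_n) :
  S \in unitmx -> vertex S i + vertex S j = vertex S i' + vertex S j' ->
  perm_eq [:: i; j] [:: i'; j'].
Proof.
move=> S_unit eq_ij.
have vertexE l : vertex S l = S *m vertex 1%:M l.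
  by case: l => [l|] /=; rewrite ?mulmx0 // !colE mul1mx.
have vertex1 m (l : 'I_n) : vertex (1%:M : 'M[R]_n) m l 0 = (m == Some l)%:R.
  case: m => [m|] /=; rewrite !mxE //.
  by rewrite (inj_eq Some_inj) eq_sym.
have count_Some l :
    count_mem (Some l) [:: i; j] = count_mem (Some l) [:: i'; j'].
  have /(congr1 (fun z => invmx S *m z)) := eq_ij.
  rewrite !vertexE -!mulmxDr !mulKmx // => /(congr1 (fun z : 'cV_n => z l 0)).
  rewrite !mxE !vertex1 -!natrD => /eqP; rewrite eqr_nat => /eqP.
  by rewrite /= !addn0.
have count_all x : count_mem x [:: i; j] = count_mem x [:: i'; j'].
  case: x => [l|]; first exact: count_Some.
  have := size_sum_count [:: i; j]; rewrite [LHS](size_sum_count [:: i'; j']).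
  rewrite (bigD1 None) // [RHS](bigD1 None) //=.
  rewrite [in RHS](eq_bigr (fun x => count_mem x [:: i'; j'])); last first.
    by case=> [l|//] _; apply: count_Some.
  by move=> /addIn ->.
by apply/allP => x _ /=; apply/eqP; apply: count_all.
Qed.

(** Unordered pairs are represented by sorted 2-tuples, which the binomial
    coefficient counts. *)
Lemma card_lattice {R : realType} {n : nat} (y : 'cV[R]_n) (S : 'M[R]_n) :
  S \in unitmx -> (lattice y S #= `I_((n.+1 * n.+2) %/ 2))%card.
Proof.
move=> S_unit.
pose A := [set t : 2.-tuple 'I_n.+1 | sorted leq (map val t)]%SET.
pose idx (l : 'I_n.+1) : option 'I_n := unlift ord0 l.
pose pt (t : 2.-tuple 'I_n.+1) :=
  y + vertex S (idx (tnth t ord0)) + vertex S (idx (tnth t ord_max)).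
have idx_inj : injective idx.
  move=> l m; rewrite /idx; case: unliftP => [l' ->|->];
    by case: unliftP => [m' ->|->] // [->].
have idx_surj i : exists l, idx l = i.
  case: i => [i|]; first by exists (lift ord0 i); rewrite /idx liftK.
  by exists ord0; rewrite /idx unlift_none.
have tupleE (t : 2.-tuple 'I_n.+1) : val t = [:: tnth t ord0; tnth t ord_max].
  by case: t => [[|a [|b [|//]]] //= st]; rewrite !(tnth_nth a).
have pt_inj : {in A &, injective pt}.
  move=> t u; rewrite !inE => sort_t sort_u; rewrite /pt -!addrA => /addrI.
  move=> /(vertex2_inj S _ _ _ _ S_unit) perm_tu.
  apply/val_inj/(inj_map val_inj).
  apply: (sorted_eq leq_trans anti_leq) => //; apply: perm_map.
  apply: (perm_map_inj idx_inj).
  by rewrite (tupleE t) (tupleE u).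
have -> : lattice y S = (fun r : 'I_#|A| => pt (enum_val r)) @` setT.
  apply/seteqP; split => [z [i [j ->]]|z [r _ <-]]; last exact: lattice_vertex2.
  have [l <-] := idx_surj i; have [m <-] := idx_surj j.
  wlog le_lm : l m {i j} / (l <= m)%N => [IH|].
    have [|/ltnW le_ml] := leqP l m; first exact: IH.
    by rewrite addrAC; apply: IH.
  have lmA : [tuple l; m] \in A by rewrite inE /= andbT.
  exists (enum_rank_in lmA [tuple l; m]) => //.
  by rewrite enum_rankK_in // /pt !(tnth_nth l).
apply: card_eq_trans (inj_card_eq _) _.
  by move=> r r' _ _ /(pt_inj _ _ (enum_valP r) (enum_valP r'))/enum_val_inj.
suff <- : #|A| = ((n.+1 * n.+2) %/ 2)%N by rewrite card_eq_sym card_II.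
by rewrite card_sorted_tuples bin2 add2n mulnC divn2.
Qed.

(** * Interpolation on the lattice *)

Definition diff2_mx {R : realType} {n : nat} (g : 'cV[R]_n -> R)
    (y : 'cV[R]_n) (S : 'M[R]_n) : 'M[R]_n :=
  \matrix_(i, j) (g (y + col i S + col j S) - g (y + col i S)
                  - g (y + col j S) + g y).

Lemma interpolant_hessian {R : realType} {n : nat} (g : 'cV[R]_n -> R)
    (y : 'cV[R]_n) (S : 'M[R]_n) (a0 : R) (a : 'cV[R]_n) (H : 'M[R]_n) :
  interpolates (lattice y S) g (a0, a, H) ->
  S^T *m H *m S = diff2_mx g y S.
Proof.
case=> + interp => /= sym_H; apply/matrixP => i j.
rewrite -mulmx_col (quad_eval_diff2 a0 a H y) // mxE.
rewrite interp; last exact: (lattice_vertex2 y S (Some i) (Some j)).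
rewrite interp; last exact: (lattice_vertex y S (Some i)).
rewrite interp; last exact: (lattice_vertex y S (Some j)).
by rewrite interp //; apply: lattice_base.
Qed.

Lemma interpolant0 {R : realType} {n : nat} (y : 'cV[R]_n) (S : 'M[R]_n)
    (a0 : R) (a : 'cV[R]_n) (H : 'M[R]_n) :
  S \in unitmx -> interpolates (lattice y S) (fun=> 0) (a0, a, H) ->
  (a0, a, H) = (0, 0, 0).
Proof.
move=> S_unit interp_c.
have ST_unit : S^T \in unitmx by rewrite unitmx_tr.
have H0 : H = 0.
  rewrite -[H](mulmxK S_unit) -[H *m S](mulKmx ST_unit) [S^T *m _]mulmxA.
  rewrite (interpolant_hessian _ _ _ _ _ _ interp_c).
  suff -> : diff2_mx (fun=> 0) y S = 0 by rewrite mulmx0 mul0mx.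
  by apply/matrixP => i j; rewrite !mxE !subr0 addr0.
case: interp_c => + interp => /= sym_H.
have q0 := interp _ (lattice_base y S).
have a_0 : a = 0.
  rewrite -[a](mulKmx ST_unit).
  suff -> : S^T *m a = 0 by rewrite mulmx0.
  apply/matrixP => i m; rewrite ord1 -dot_col [RHS]mxE.
  have := interp _ (lattice_vertex y S (Some i)).
  rewrite quad_evalD // q0 H0.
  by rewrite !mulmx0 !mul0mx !mxE mulr0 !addr0 add0r.
move: q0; rewrite H0 a_0 /quad_eval linear0 !mul0mx mulmx0 mul0mx !mxE.
by rewrite mulr0 !addr0 => ->.
Qed.

(** In the coordinates centred at y, the Hessian is given by the second
    differences, and the gradient b is chosen to match the data at y + s^i; the
    data at y + s^i + s^j are then matched because their second differences
    are.  The coefficients are those of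
    g y + b^T (x - y) + (x - y)^T H (x - y) / 2, expanded in powers of x. *)
Lemma interpolant_exists {R : realType} {n : nat} (g : 'cV[R]_n -> R)
    (y : 'cV[R]_n) (S : 'M[R]_n) :
  S \in unitmx -> exists c, interpolates (lattice y S) g c.
Proof.
move=> S_unit; have ST_unit : S^T \in unitmx by rewrite unitmx_tr.
pose D := diff2_mx g y S.
pose H := invmx S^T *m D *m invmx S.
pose d := \col_i (g (y + col i S) - g y - 2^-1 * D i i) : 'cV[R]_n.
pose b := invmx S^T *m d.
have sym_D : D^T = D.
  apply/matrixP => i j; rewrite !mxE [y + _ + _]addrAC; ring.
have sym_H : H^T = H.
  by rewrite /H !trmx_mul sym_D !trmx_inv trmxK mulmxA.
have SHS : S^T *m H *m S = D by rewrite /H !mulmxA mulmxV // mul1mx mulmxKV.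
have SHSE i j : ((col i S)^T *m H *m col j S) 0 0 = D i j.
  by rewrite mulmx_col SHS.
have bE i : (b^T *m col i S) 0 0 = d i 0 by rewrite dot_col mulKVmx.
pose a := b - H *m y.
pose a0 := g y - (a^T *m y) 0 0 - 2^-1 * (y^T *m H *m y) 0 0.
have qy : quad_eval (a0, a, H) y = g y by rewrite /quad_eval /a0; ring.
have qD u : quad_eval (a0, a, H) (y + u)
          = g y + (b^T *m u) 0 0 + 2^-1 * (u^T *m H *m u) 0 0.
  rewrite quad_evalD // qy /a [(b - _)^T]linearB /= [(H *m y)^T]trmx_mul sym_H.
  by rewrite mulmxBl submxE; ring.
have qs i : quad_eval (a0, a, H) (y + vertex S i) = g (y + vertex S i).
  case: i => [i|]; last by rewrite addr0.
  by rewrite qD /= bE SHSE mxE; ring.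
exists (a0, a, H); split=> // z [i [j ->]].
have := quad_eval_diff2 a0 a H y (vertex S i) (vertex S j) sym_H.
rewrite !qs qy.
have -> : ((vertex S i)^T *m H *m vertex S j) 0 0
    = g (y + vertex S i + vertex S j) - g (y + vertex S i)
      - g (y + vertex S j) + g y.
  case: i j => [i|] [j|]; rewrite /= ?addr0 ?mulmx0 ?linear0 ?mul0mx.
  - by rewrite SHSE mxE.
  - by rewrite mxE; ring.
  - by rewrite mxE; ring.
  - by rewrite mxE; ring.
by move=> /addIr/addIr/addIr <-.
Qed.

Lemma poised_lattice {R : realType} {n : nat} (y : 'cV[R]_n) (S : 'M[R]_n) :
  S \in unitmx -> poised_quad (lattice y S).
Proof.
move=> S_unit; split; first exact: card_lattice.
exists (0, 0, 0); split=> [|[[a0 a] H] interp].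
  split=> [|z _] /=; first by rewrite linear0.
  by rewrite linear0 mulmx0 !mul0mx !mxE mulr0 !addr0.
by rewrite (interpolant0 y S a0 a H).
Qed.

Lemma quad_interp_lattice {R : realType} {n : nat} {domf : set 'cV[R]_n}
    (f : domf -> R) (y : 'cV[R]_n) (S : 'M[R]_n) :
  S \in unitmx -> lattice y S `<=` domf ->
  interpolates (lattice y S) (valL_ 0 f) (quad_interp f (lattice y S)).
Proof.
move=> S_unit sub_dom; rewrite /quad_interp; case: xgetP => [c _ [] //|no_c].
have [c interp_c] := interpolant_exists (valL_ 0 f) y S S_unit.
by case: (no_c c); split=> //; apply: poised_lattice.
Qed.

(** * The coefficients *)

Theorem proposition3p8 (R : realType) (n : nat) (domf : set 'cV[R]_n)
    (f : domf -> R) (x0 : 'cV[R]_n) (S : 'M[R]_n) (k : option 'I_n)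
    (a0 : R) (a : 'cV[R]_n) (H : 'M[R]_n) :
  \rank S = n ->
  Mset x0 S k `<=` domf ->
  quad_interp f (Mset x0 S k) = (a0, a, H) ->
  let F := valL_ 0 f in
  let s i := col i S in
  exists (Hhat : 'M[R]_n) (abar : 'cV[R]_n),
    [/\ Hhat^T = Hhat,
        H = invmx S^T *m Hhat *m invmx S,
        match k with
        | Some k =>
          [/\ forall i, i != k ->
                Hhat i k = - F (x0 + s i - s k) + F (x0 + s i)
                           + F (x0 - s k) - F x0,
              forall i, i != k ->
                Hhat i i = F (x0 + 2 *: s i - s k) - 2 * F (x0 + s i - s k)
                           + F (x0 - s k),
              Hhat k k = F (x0 + s k) + F (x0 - s k) - 2 * F x0 &
              forall i j, i != k -> j != k -> i != j ->
                Hhat i j = F (x0 + s i + s j - s k) - F (x0 + s i - s k)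
                           - F (x0 + s j - s k) + F (x0 - s k)]
        | None =>
            (forall i,
                Hhat i i = F (x0 + 2 *: s i) - 2 * F (x0 + s i) + F x0) /\
            (forall i j, i != j ->
                Hhat i j = F (x0 + s i + s j) - F (x0 + s i)
                           - F (x0 + s j) + F x0)
        end &
        [/\ a = invmx S^T *m abar,
            forall i, abar i 0 = F (x0 + s i) - F x0 - 2^-1 * Hhat i i
                                 - (x0^T *m H *m s i) 0 0 &
            a0 = F x0 - (a^T *m x0) 0 0 - 2^-1 * (x0^T *m H *m x0) 0 0]].
Proof.
move=> rank_S + + F s; rewrite Mset_lattice => sub_dom interp_eq.
have S_unit : S \in unitmx by rewrite -row_free_unit /row_free rank_S.
have ST_unit : S^T \in unitmx by rewrite unitmx_tr.
have := quad_interp_lattice f _ S S_unit sub_dom; rewrite interp_eq.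
move=> interp_c; have hess := interpolant_hessian _ _ _ _ _ _ interp_c.
case: interp_c => + interp => /= sym_H.
have interp_x0 z : lattice (x0 - vertex S k) S z ->
    quad_eval (a0, a, H) z = F z.
  exact: interp.
have qx0 : quad_eval (a0, a, H) x0 = F x0.
  by apply: interp_x0; exists k, None; rewrite addr0 subrK.
exists (S^T *m H *m S), (S^T *m a); split.
- by rewrite !trmx_mul trmxK sym_H mulmxA.
- by rewrite mulmxA mulmxK // mulKmx.
- rewrite hess -/F; case: k {sub_dom interp_eq hess interp interp_x0} => [k|] /=.
    (* The entries at the base point x0 - s^k are put in the stated form by
       moving s^k to the end, where it cancels against an added s^k. *)
    have shift u : x0 - s k + u = x0 + u - s k by rewrite addrAC.
    have shift2 u v : x0 - s k + u + v = x0 + u + v - s k.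
      by rewrite shift addrAC.
    split=> [i _|i _||i j _ _ _]; rewrite mxE -!/(s _).
    + by rewrite shift2 addrK subrK shift; ring.
    + by rewrite shift2 shift scaler_nat mulr2n addrA; ring.
    + by rewrite !subrK; ring.
    + by rewrite shift2 !shift; ring.
  split=> [i|i j _]; rewrite mxE -!/(s _) subr0 //.
  by rewrite scaler_nat mulr2n addrA; ring.
- split.
  + by rewrite mulKmx.
  + move=> i; rewrite -dot_col -mulmx_col -/(s i).
    rewrite -(interp_x0 (x0 + s i)); last by exists k, (Some i); rewrite subrK.
    by rewrite quad_evalD // qx0; ring.
  + by rewrite -qx0 /=; ring.
Qed.
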